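(* Suppose that $A=(a_{ij}),B=(b_{ij})\in\mathbb{R}_{\max}^{m\times n}$ have no rows identically equal to $-\infty$ and no columns identically equal to $-\infty$. Then $$\mathrm{spec}(A,B)\subseteq[-r(A^{\sharp}B),\,r(B^{\sharp}A)]\subseteq[\underline{D}(A,B),\,\overline{D}(A,B)].$$
   Context: $\mathbb{R}_{\max}=\mathbb{R}\cup\{-\infty\}$. For $A=(a_{ij})\in\mathbb{R}_{\max}^{m\times n}$ and $x\in\mathbb{R}_{\max}^n$, $(Ax)_i=\max_j(a_{ij}+x_j)$. For $y\in\mathbb{R}_{\max}^m$, $(A^{\sharp}y)_j=\min_{1\le i\le m}(-a_{ij}+y_i)$ with $(-\infty)+(+\infty)=+\infty$. $A^{\sharp}B$ denotes the composition $x\mapsto A^{\sharp}(Bx)$, an operator on $\mathbb{R}_{\max}^n$. For an order-preserving, additively homogeneous, continuous map $f$ of $\mathbb{R}_{\max}^n$ to itself, $r(f)=\max\{\lambda\in\mathbb{R}_{\max}\mid\exists x\in\mathbb{R}_{\max}^n,\ x\not\equiv-\infty,\ \lambda+x=f(x)\}$ (continuity with respect to the metric $\max_i|e^{x_i}-e^{y_i}|$). $\mathrm{spec}(A,B)$ is the set of finite $\lambda\in\mathbb{R}$ for which there is $x\in\mathbb{R}_{\max}^n$ with at least one component not equal to $-\infty$ and $Ax=\lambda+Bx$ (i.e. $\max_j(a_{ij}+x_j)=\lambda+\max_j(b_{ij}+x_j)$ for all $i$). A row is called finite if all its entries are real. For vectors $z,y$ put $z/y=\max\{\gamma\mid\gamma+y\le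 z\}=\min_{j:\,y_j\neq-\infty}(z_j-y_j)$. With $A_{i\cdot}$ the $i$-th row of $A$, define $\underline{D}(A,B)=\max_{i:\,A_{i\cdot}\text{ finite}}A_{i\cdot}/B_{i\cdot}$ and $\overline{D}(A,B)=-\max_{i:\,B_{i\cdot}\text{ finite}}B_{i\cdot}/A_{i\cdot}$, where a maximum over the empty set is $-\infty$ (so that $\overline D=+\infty$ if $B$ has no finite row). Intervals with infinite endpoints or with left end exceeding right end (empty) are allowed. *)

(* Defs.v *)
From HB Require Import structures.
From mathcomp Require Export all_boot all_order all_algebra.
From mathcomp Require Export boolp classical_sets set_interval reals
  constructive_ereal ereal.

Set Implicit Arguments.
Unset Strict Implicit.
Unset Printing Implicit Defensive.

Import Order.TTheory GRing.Theory Num.Theory.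

Local Open Scope classical_set_scope.
Local Open Scope ring_scope.
Local Open Scope ereal_scope.

(* R_max = R U {-oo} is the part of \bar R that avoids +oo. *)
Definition mx_Rmax (R : realType) (m n : nat) (A : 'M[\bar R]_(m, n)) : Prop :=
  forall i j, A i j != +oo.

(* The set over which r(f) is a maximum. *)
Definition eigenvalues (R : realType) (n : nat)
    (f : 'cV[\bar R]_n -> 'cV[\bar R]_n) : set (\bar R) :=
  [set l | l != +oo /\
    exists x : 'cV[\bar R]_n, [/\ mx_Rmax x, exists j, x j 0%R != -oo
      & forall j, l + x j 0%R = f x j 0%R]].

(* Maximum of a set, as opposed to its supremum: it must belong to the set.
   The value when there is no maximum is -oo by convention. *)
Definition max_set (R : realType) (S : set (\bar R)) : \bar R :=
  xget -oo [set l | S l /\ ubound S l].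

(* r(f); meaningful for f order-preserving, additively homogeneous and
   continuous on R_max^n, n > 0, in which case the maximum is attained. *)
Definition spectral_radius (R : realType) (n : nat)
    (f : 'cV[\bar R]_n -> 'cV[\bar R]_n) : \bar R :=
  max_set (eigenvalues f).

Definition maxplus_mul (R : realType) (m n : nat) (A : 'M[\bar R]_(m, n))
    (x : 'cV[\bar R]_n) : 'cV[\bar R]_m :=
  \col_i \big[maxe/-oo]_(j < n) (A i j + x j 0%R).

(* The dual addition %dE is the one for which -oo + +oo = +oo. *)
Definition sharp (R : realType) (m n : nat) (A : 'M[\bar R]_(m, n))
    (y : 'cV[\bar R]_m) : 'cV[\bar R]_n :=
  \col_j \big[mine/+oo]_(i < m) (- A i j + y i 0%R)%dE.

Definition sharp_mul (R : realType) (m n : nat) (A B : 'M[\bar R]_(m, n)) :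
    'cV[\bar R]_n -> 'cV[\bar R]_n :=
  sharp A \o maxplus_mul B.

Definition spec (R : realType) (m n : nat) (A B : 'M[\bar R]_(m, n)) : set R :=
  [set l : R | exists x : 'cV[\bar R]_n, [/\ mx_Rmax x, exists j, x j 0%R != -oo
    & forall i, maxplus_mul A x i 0%R = l%:E + maxplus_mul B x i 0%R]].

(* z / y *)
Definition vdiv (R : realType) (n : nat) (z y : 'rV[\bar R]_n) : \bar R :=
  \big[mine/+oo]_(j < n | y 0%R j != -oo) (z 0%R j - y 0%R j).

Definition finite_row (R : realType) (m n : nat) (A : 'M[\bar R]_(m, n))
    (i : 'I_m) : bool :=
  [forall j, A i j \is a fin_num].

Definition D_lower (R : realType) (m n : nat) (A B : 'M[\bar R]_(m, n)) :
    \bar R :=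
  \big[maxe/-oo]_(i < m | finite_row A i) vdiv (row i A) (row i B).

Definition D_upper (R : realType) (m n : nat) (A B : 'M[\bar R]_(m, n)) :
    \bar R :=
  - \big[maxe/-oo]_(i < m | finite_row B i) vdiv (row i B) (row i A).

Lemma max_setE (R : realType) (S : set (\bar R)) (l : \bar R) :
  S l -> ubound S l -> max_set S = l.
Proof.
move=> Sl ubl; rewrite /max_set; case: xgetP => [k _ [Sk ubk]|/(_ l)[]//].
by apply/eqP; rewrite eq_le ubl// ubk.
Qed.

(* z / y is the largest g such that g + y <= z. *)
Lemma vdivP (R : realType) (n : nat) (z y : 'rV[\bar R]_n) (g : \bar R) :
  mx_Rmax z -> mx_Rmax y ->
  (forall j, g + y 0%R j <= z 0%R j) <-> g <= vdiv z y.
Proof.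
move=> zR yR; split=> [gyz|/bigmin_geP[_ gle] j].
  apply/bigmin_geP; split=> [|j yj]; first exact: leey.
  by rewrite leeBrDr ?gyz// fin_numE yj yR.
have [->|yj] := eqVneq (y 0%R j) -oo; first by rewrite addeNy leNye.
by rewrite -leeBrDr ?gle// fin_numE yj yR.
Qed.

Lemma maxplus_mul_Rmax (R : realType) (m n : nat) (A : 'M[\bar R]_(m, n))
    (x : 'cV[\bar R]_n) :
  mx_Rmax A -> mx_Rmax x -> mx_Rmax (maxplus_mul A x).
Proof.
move=> AR xR i k; rewrite mxE -ltey; apply/bigmax_ltP; split=> // j _.
by rewrite lte_add_pinfty// ltey.
Qed.

Lemma sharp_Rmax (R : realType) (m n : nat) (A : 'M[\bar R]_(m, n))
    (y : 'cV[\bar R]_m) :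
  mx_Rmax A -> (forall j, exists i, A i j != -oo) -> mx_Rmax y ->
  mx_Rmax (sharp A y).
Proof.
move=> AR Acol yR j k; rewrite mxE -ltey; have [i Aij] := Acol j.
apply/bigmin_ltP; right; exists i => //; rewrite ltey.
by move: (AR i j) (yR i 0%R) Aij; case: (A i j) => // a; case: (y i 0%R).
Qed.

(* Main.v *)
(** A sub-eigenvector [l + x <= f x] of [f = sharp_mul A B] forces [l <= r(f)].
  First, there is a greatest sub-eigenvalue [L]: for each sub-eigenvalue [l] take the
  greatest vector [<= 0] that is a sub-eigenvector for [l]; these vectors decrease in
  [l] and their infimum is a nontrivial sub-eigenvector for the supremum of all [l].
  Subtracting [L], suppose [L = 0] and let [z <= f z]. If the orbit of [z] is bounded,
  its limit is a fixed point. Otherwise let [I] be the set of coordinates tending to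
  [+oo]. Late in the orbit the maxima defining [f] on [I] are attained in [I], so the
  orbit restricted to [I] dominates itself plus 1 after some number [K] of steps;
  the maximum over [p < K] of the [p]-th iterates lowered by [p / K] is then a
  sub-eigenvector for [1 / K], contradicting the choice of [L].

  With [A x = l + B x], residuation shows that [x] is a sub-eigenvector of
  [sharp_mul A B] for [- l] and of [sharp_mul B A] for [l]. The outer bounds follow by
  evaluating an eigenvector equation at a coordinate [j] where [A i j + x j] is maximal,
  [i] being a finite row of [A]. *)

Require Import Defs.
From mathcomp Require Import lra.

Set Implicit Arguments.
Unset Strict Implicit.
Unset Printing Implicit Defensive.

Import Order.TTheory GRing.Theory Num.Theory.

Local Open Scope classical_set_scope.
Local Open Scope ring_scope.
Local Open Scope ereal_scope.

(** * Residuation, monotonicity and homogeneity of [sharp_mul A B] *)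

Lemma fin_num_maxP (R : realType) (n : nat) (x : 'cV[\bar R]_n) :
  mx_Rmax x -> (exists j, x j 0%R != -oo) ->
  exists j (r : R), x j 0%R = r%:E /\ forall k, x k 0%R <= r%:E.
Proof.
move=> xR [j0 xj0].
case: (@arg_maxP _ _ _ j0 predT (fun k => x k 0%R) isT) => j _ jmax.
have := jmax j0 isT; move: (xR j 0%R) jmax; case E: (x j 0%R) => [r| |] //.
  by move=> _ jmax _; exists j, r; split=> // k; apply: jmax.
by move=> _ _ /=; rewrite leeNy_eq (negbTE xj0).
Qed.

Lemma le_maxplus_mul (R : realType) (m n : nat) (A : 'M[\bar R]_(m, n))
    (x : 'cV[\bar R]_n) (i : 'I_m) (t : \bar R) : (0 < n)%N ->
  t <= maxplus_mul A x i 0%R <-> exists k, t <= A i k + x k 0%R.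
Proof.
move=> n0; rewrite mxE; split; last by case=> k tk; apply/bigmax_geP; right; exists k.
case/bigmax_geP => [tN|[k _ tk]]; last by exists k.
by exists (Ordinal n0); apply: le_trans tN (leNye _).
Qed.

(** Residuation, checked entry by entry. An entry [-oo] of [A] constrains nothing on either side,
    thanks to the dual addition. *)
Lemma le_sharp (R : realType) (m n : nat) (A : 'M[\bar R]_(m, n))
    (y : 'cV[\bar R]_m) (j : 'I_n) (t : \bar R) :
  mx_Rmax A -> mx_Rmax y ->
  t <= sharp A y j 0%R <-> forall i, A i j + t <= y i 0%R.
Proof.
move=> AR yR.
have H i : (t <= (- A i j + y i 0%R)%dE) = (A i j + t <= y i 0%R).
  move: (AR i j) (yR i 0%R); case: (A i j) => [a| |] //; case: (y i 0%R) => [b| |] //;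
    case: t => [s| |] //= _ _; last first;
    try by rewrite ?DualAddTheoryNumDomain.daddye ?addNye ?addeNy ?leey ?leNye.
  by rewrite -DualAddTheoryNumDomain.dEFinD -EFinD !lee_fin; lra.
rewrite mxE; split.
  by case/bigmin_geP => _ tle i; rewrite -H; apply: tle.
by move=> tle; apply/bigmin_geP; split=> [|i _]; rewrite ?leey// H.
Qed.

Definition shift (R : realType) (n : nat) (c : R) (x : 'cV[\bar R]_n) :
  'cV[\bar R]_n := \col_j (c%:E + x j 0%R).

Definition subeigenvector (R : realType) (n : nat)
    (f : 'cV[\bar R]_n -> 'cV[\bar R]_n) (l : R) (x : 'cV[\bar R]_n) : Prop :=
  [/\ mx_Rmax x, exists j, x j 0%R != -oo
    & forall j, l%:E + x j 0%R <= f x j 0%R].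

Lemma shift_Rmax (R : realType) (n : nat) (c : R) (x : 'cV[\bar R]_n) :
  mx_Rmax x -> mx_Rmax (shift c x).
Proof.
by move=> xR i j; rewrite ord1 mxE; move: (xR i 0%R); case: (x i 0%R).
Qed.

Lemma shiftK (R : realType) (n : nat) (c : R) :
  cancel (@shift R n c) (shift (- c)).
Proof.
by move=> x; apply/matrixP=> i k; rewrite ord1 !mxE addeA -EFinD addNr add0e.
Qed.

Lemma maxplus_mul_mono (R : realType) (m n : nat) (A : 'M[\bar R]_(m, n))
    (x y : 'cV[\bar R]_n) (i : 'I_m) : (forall j, x j 0%R <= y j 0%R) ->
  maxplus_mul A x i 0%R <= maxplus_mul A y i 0%R.
Proof. by move=> xy; rewrite !mxE; apply: le_bigmax2 => j _; apply: leeD2l. Qed.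

(** Having one witness [k] per row [i] reduces later limit arguments to choices in a finite set. *)
Lemma le_sharp_mul (R : realType) (m n : nat) (A B : 'M[\bar R]_(m, n))
    (x : 'cV[\bar R]_n) (j : 'I_n) (t : \bar R) :
  (0 < n)%N -> mx_Rmax A -> mx_Rmax B -> mx_Rmax x ->
  t <= sharp_mul A B x j 0%R <->
  forall i, exists k, A i j + t <= B i k + x k 0%R.
Proof.
move=> n0 AR BR xR; apply: iff_trans (le_sharp _ _ AR (maxplus_mul_Rmax BR xR)) _.
by split=> H i; apply/(le_maxplus_mul _ _ _ _ n0).
Qed.

Lemma sharp_mul_mono (R : realType) (m n : nat) (A B : 'M[\bar R]_(m, n))
    (x y : 'cV[\bar R]_n) (j : 'I_n) :
  (forall k, x k 0%R <= y k 0%R) ->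
  sharp_mul A B x j 0%R <= sharp_mul A B y j 0%R.
Proof.
move=> xy; rewrite /sharp_mul/= !mxE; apply: le_bigmin2 => i _.
exact/DualAddTheoryRealDomain.lee_dD2l/maxplus_mul_mono.
Qed.

Lemma sharp_mul_shift (R : realType) (m n : nat) (A B : 'M[\bar R]_(m, n))
    (c : R) (x : 'cV[\bar R]_n) (j : 'I_n) :
  (0 < n)%N -> mx_Rmax A -> mx_Rmax B -> mx_Rmax x ->
  sharp_mul A B (shift c x) j 0%R = c%:E + sharp_mul A B x j 0%R.
Proof.
move=> n0 AR BR xR.
have H (d : R) (z : 'cV[\bar R]_n) : mx_Rmax z ->
    d%:E + sharp_mul A B z j 0%R <= sharp_mul A B (shift d z) j 0%R.
  move=> zR; apply/le_sharp_mul=> //; first exact: shift_Rmax.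
  move=> i; have /(le_sharp_mul _ _ n0 AR BR zR)/(_ i)[k kle] :=
    lexx (sharp_mul A B z j 0%R).
  by exists k; rewrite addeCA [shift _ _ _ _]mxE [leRHS]addeCA leeD2l.
(* The reverse inequality is [H] for [- c] at the shifted vector. *)
apply/le_anti/andP; split; last exact: H.
by have := H (- c)%R _ (shift_Rmax c xR); rewrite shiftK => /(leeD2l c%:E);
  rewrite addeA -EFinD subrr add0e.
Qed.

Lemma sharp_mul_Rmax (R : realType) (m n : nat) (A B : 'M[\bar R]_(m, n))
    (x : 'cV[\bar R]_n) :
  mx_Rmax A -> mx_Rmax B -> (forall j, exists i, A i j != -oo) ->
  mx_Rmax x -> mx_Rmax (sharp_mul A B x).
Proof.
by move=> AR BR Acol xR; apply: sharp_Rmax => //; apply: maxplus_mul_Rmax.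
Qed.

(** * Growth of orbits and existence of fixed points *)

Lemma subeigenvector_of_iter (R : realType) (m n : nat)
    (A B : 'M[\bar R]_(m, n)) (z : 'cV[\bar R]_n) (d : R) (K : nat) :
  (0 < n)%N -> mx_Rmax A -> mx_Rmax B -> (forall j, exists i, A i j != -oo) ->
  mx_Rmax z -> (exists j, z j 0%R != -oo) ->
  (forall j, (K.+1%:R * d)%:E + z j 0%R <=
    iter K.+1 (sharp_mul A B) z j 0%R) ->
  exists x, subeigenvector (sharp_mul A B) d x.
Proof.
move=> n0 AR BR Acol zR [j0 zj0] zle; set f := sharp_mul A B.
have fR p : mx_Rmax (iter p f z).
  by elim: p => //= p IH; apply: sharp_mul_Rmax.
pose w : 'cV[\bar R]_n :=
  \col_j \big[maxe/-oo]_(p < K.+1) shift (- (p%:R * d)) (iter p f z) j 0%R.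
have le_w p j : (p < K.+1)%N -> shift (- (p%:R * d)) (iter p f z) j 0%R <= w j 0%R.
  by move=> pK; rewrite [w _ _]mxE; apply/bigmax_geP; right; exists (Ordinal pK).
have le_fw p j : (p < K.+1)%N ->
    (- (p%:R * d))%:E + iter p.+1 f z j 0%R <= f w j 0%R.
  move=> pK; rewrite iterS -sharp_mul_shift //.
  by apply: sharp_mul_mono => k; apply: le_w.
exists w; split.
- move=> j i; rewrite ord1 mxE -ltey; apply/bigmax_ltP; split=> // p _.
  by rewrite ltey; apply: shift_Rmax.
- exists j0; rewrite -ltNye; apply: lt_le_trans (le_w 0%N j0 isT).
  by rewrite mxE mul0r oppr0 add0e ltNye.
- move=> j; rewrite addeC -leeBrDr // [w _ _]mxE; apply/bigmax_leP; split.
    exact: leNye.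
  (* Raised by [d], term [p.+1] of [w] lies below [f] of term [p]; term 0 lies below [f] of term
     [K], by the hypothesis on [K.+1] iterations. *)
  move=> [[|p] pK] _; rewrite leeBrDr // mxE.
    rewrite mul0r oppr0 add0e; apply: le_trans (le_fw K j (ltnSn K)).
    apply: le_trans (leeD2l _ (zle j)); rewrite addeA -EFinD addeC.
    by rewrite -natr1 mulrDl mul1r addKr.
  apply: le_trans (le_fw p j (ltnW pK)); rewrite addeAC -EFinD leeD2r //.
  by rewrite lee_fin -natr1; lra.
Qed.

Lemma eventually_finite (T : finType) (P : T -> nat -> Prop) :
  (forall t, exists N, forall k, (N <= k)%N -> P t k) ->
  exists N, forall k, (N <= k)%N -> forall t, P t k.
Proof.
move=> /choice[N HN]; exists (\max_t N t) => k Nk t; apply: HN.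
exact: leq_trans (leq_bigmax t) Nk.
Qed.

Lemma fixed_point (R : realType) (m n : nat)
    (A B : 'M[\bar R]_(m, n)) (x0 : 'cV[\bar R]_n) :
  (0 < n)%N -> mx_Rmax A -> mx_Rmax B -> (forall j, exists i, A i j != -oo) ->
  subeigenvector (sharp_mul A B) 0 x0 ->
  (forall (l : R) x, (0 < l)%R -> ~ subeigenvector (sharp_mul A B) l x) ->
  exists x, [/\ mx_Rmax x, exists j, x j 0%R != -oo
    & forall j, sharp_mul A B x j 0%R = x j 0%R].
Proof.
move=> n0 AR BR Acol [x0R [j0 x0j0] x0le] nosub; set f := sharp_mul A B.
pose u k := iter k f x0.
have uR k : mx_Rmax (u k) by elim: k => //= k IH; apply: sharp_mul_Rmax.
have uS k j : u k j 0%R <= u k.+1 j 0%R.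
  elim: k j => [|k IH] j; first by have := x0le j; rewrite add0e.
  exact: sharp_mul_mono.
have u_mono j k k' : (k <= k')%N -> u k j 0%R <= u k' j 0%R.
  by move/subnKC <-; elim: (k' - k)%N => [|d IH];
    rewrite ?addn0// addnS (le_trans IH).
pose y : 'cV[\bar R]_n := \col_j ereal_sup (range (fun k => u k j 0%R)).
have u_le_y k j : u k j 0%R <= y j 0%R.
  by rewrite [y _ _]mxE; apply: ereal_sup_ubound; exists k.
have y_lim j (t : \bar R) : t < y j 0%R ->
    exists N, forall k, (N <= k)%N -> t < u k j 0%R.
  rewrite [y _ _]mxE => /ereal_sup_gt[_ [N _ <-]] tN.
  by exists N => k Nk; apply: lt_le_trans tN (u_mono j _ _ Nk).
have [yR|yI] := pselect (forall j, y j 0%R != +oo).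
  have yR' : mx_Rmax y by move=> j i; rewrite ord1.
  exists y; split=> //.
    exists j0; rewrite -ltNye; apply: lt_le_trans (u_le_y 0%N j0).
    by rewrite ltNye.
  move=> j; apply/le_anti/andP; split; last first.
    rewrite [y _ _]mxE; apply: ge_ereal_sup => _ [k _ <-].
    by apply: le_trans (uS k j) _; apply: sharp_mul_mono.
  (* Continuity by hand: if [y <= e + u N] in all coordinates at once, then
     [f y <= e + u N.+1 <= e + y]. *)
  apply/lee_addgt0Pr => e e0.
  have [N yN] : exists N, forall k, (N <= k)%N ->
      forall j, y j 0%R <= e%:E + u k j 0%R.
    apply: eventually_finite => i.
    have := u_le_y 0%N i; have := @y_lim i (y i 0%R - e%:E).
    move: (yR i); case: (y i 0%R) => [r| |] // _; last first.
      by move=> _ _; exists 0%N => k _; apply: leNye.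
    case=> [|N rN _]; first by rewrite -EFinB lte_fin; lra.
    by exists N => k /rN; rewrite lteBlDl // => /ltW.
  have /= := @sharp_mul_mono _ _ _ A B y (shift e (u N)) j.
  rewrite sharp_mul_shift // addeC => /(_ _)/le_trans; apply.
    by move=> k; rewrite [shift _ _ _ _]mxE yN.
  by rewrite leeD2r // (u_le_y N.+1).
exfalso.
have {yI}[j1 yj1] : exists j, y j 0%R = +oo.
  apply: contrapT => yN; apply: yI => j; apply/eqP => yj; apply: yN.
  by exists j.
pose I := [pred j | y j 0%R == +oo].
have [N1 HN1] : exists N, forall k, (N <= k)%N -> forall j,
    I j -> 0 < u k j 0%R.
  apply: eventually_finite => j; case: (boolP (I j)) => [/eqP yj|_].
    by have [|N HN] := y_lim j 0; [rewrite yj ltry | exists N => k /HN].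
  by exists 0%N.
(* A coordinate outside [I] stays below its finite limit, so it cannot keep pace with one in [I]:
   late witnesses [k] lie in [I]. *)
have [N2 HN2] : exists N, forall k, (N <= k)%N ->
    forall p : 'I_m * 'I_n * 'I_n, I p.1.2 -> ~~ I p.2 -> A p.1.1 p.1.2 != -oo ->
    B p.1.1 p.2 + u k p.2 0%R < A p.1.1 p.1.2 + u k.+1 p.1.2 0%R.
  apply: eventually_finite => -[[i j] l] /=.
  have [yj|] := eqVneq (y j 0%R) +oo; last by exists 0%N.
  have [_|yl] := eqVneq (y l 0%R) +oo; first by exists 0%N.
  move: (AR i j); case: (A i j) => [a| |] // _; last by exists 0%N.
  have [|N HN] := y_lim j (B i l + y l 0%R - a%:E).
    rewrite yj; move: (BR i l) yl.
    by case: (B i l) => [b| |] //; case: (y l 0%R) => [r| |] // _ _; rewrite ltry.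
  exists N => k Nk _ _ _; apply: le_lt_trans (leeD2l _ (u_le_y k l)) _.
  rewrite -lteBlDl //; exact: (HN k.+1 (leqW Nk)).
pose N := maxn N1 N2.
(* Coordinates outside [I] cannot gain 1, so they are dropped; [fz] shows that the orbit on [I]
   loses nothing by this. *)
pose restr (x : 'cV[\bar R]_n) : 'cV[\bar R]_n :=
  \col_j if I j then x j 0%R else -oo.
pose z := restr (u N).
have zR : mx_Rmax z.
  by move=> j i; rewrite ord1 mxE; case: ifP => // _; apply: uR.
have fz p j : I j -> u (N + p)%N j 0%R <= iter p f z j 0%R.
  have itR q : mx_Rmax (iter q f z) by elim: q => //= q IH; apply: sharp_mul_Rmax.
  elim: p j => [|p IH] j Ij; first by rewrite addn0 /= mxE Ij.
  rewrite addnS iterS; apply/le_sharp_mul => // i.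
  have /(le_sharp_mul _ _ n0 AR BR (uR _))/(_ i)[k kle] := lexx (u (N + p).+1 j 0%R).
  have [Aij|Aij] := eqVneq (A i j) -oo.
    by exists j; rewrite Aij addNye leNye.
  have [Ik|Ik] := boolP (I k).
    by exists k; apply: le_trans kle _; apply/leeD2l/IH.
  have NNp : (N2 <= N + p)%N := leq_trans (leq_maxr _ _) (leq_addr _ _).
  have /(_ (i, j, k) Ij Ik Aij) := HN2 _ NNp.
  by rewrite /= ltNge kle.
have [K HK] : exists K, forall k, (K <= k)%N -> forall j, I j ->
    1 + u N j 0%R < u k j 0%R.
  apply: eventually_finite => j; case: (boolP (I j)) => [/eqP yj|_]; last by exists 0%N.
  have [|K HK] := y_lim j (1 + u N j 0%R); last by exists K => k /HK.
  by rewrite yj; move: (uR N j 0%R); case: (u N j 0%R) => // r _; rewrite ltry.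
(* A gain of 1 in [K.+1] steps is a rate of [K.+1%:R^-1] per step. *)
have [||x] := @subeigenvector_of_iter _ _ _ A B z K.+1%:R^-1 K n0 AR BR Acol zR.
- exists j1; rewrite mxE inE yj1 eqxx -ltNye.
  by apply: le_lt_trans (HN1 N (leq_maxl _ _) j1 _); rewrite ?leNye // inE yj1.
- move=> j; rewrite mulfV ?pnatr_eq0 //.
  have [Ij|Ij] := boolP (I j); last by rewrite mxE (negbTE Ij) addeNy leNye.
  apply: le_trans (fz _ _ Ij); rewrite [z _ _]mxE Ij.
  by apply/ltW/HK => //; rewrite addnS -addSn leq_addl.
by apply: nosub; rewrite invr_gt0 ltr0n.
Qed.

(** * The greatest sub-eigenvalue *)

(** If each [t] failed at some [g t] in [S], a [t] valid at the largest of these values would, by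
    antitonicity, also be valid at [g t]. *)
Lemma antitone_pigeonhole (R : realType) (T : finType) (t0 : T) (S : set R)
    (P : R -> T -> Prop) :
  (forall l l' t, (l <= l')%R -> P l' t -> P l t) ->
  (forall l, S l -> exists t, P l t) ->
  exists t, forall l, S l -> P l t.
Proof.
move=> Pmono PS; apply: contrapT => noT.
have /choice[g Hg] : forall t, exists l, S l /\ ~ P l t.
  move=> t; apply: contrapT => Hl; apply: noT; exists t => l Sl.
  by apply: contrapT => nP; apply: Hl; exists l.
case: (@arg_maxP _ _ _ t0 predT g isT) => s _ smax.
have [t Pt] := PS _ (Hg s).1; apply: (Hg t).2.
exact: Pmono (smax t isT) Pt.
Qed.

Lemma subeigenvalue_max (R : realType) (m n : nat) (A B : 'M[\bar R]_(m, n))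
    (l0 : R) (x0 : 'cV[\bar R]_n) :
  (0 < n)%N -> mx_Rmax A -> mx_Rmax B -> (forall j, exists i, A i j != -oo) ->
  subeigenvector (sharp_mul A B) l0 x0 ->
  exists L : R, (exists x, subeigenvector (sharp_mul A B) L x) /\
    forall l x, subeigenvector (sharp_mul A B) l x -> (l <= L)%R.
Proof.
move=> n0 AR BR Acol x0l0; set f := sharp_mul A B.
pose S := [set l : R | exists x, subeigenvector f l x].
have S0 : S !=set0 by exists l0, x0.
have Sub : has_ubound S.
  (* The bound comes from a coordinate [j] where [x] is maximal. The entries [A i j] and [B i k]
     used there are finite, so [fine] does no harm. *)
  exists (\big[Num.max/0%R]_(p : 'I_m * 'I_n * 'I_n)
    (fine (B p.1.1 p.2) - fine (A p.1.1 p.1.2))%R) => l [x [xR xN xle]].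
  have [j [r [xj xmax]]] := fin_num_maxP xR xN.
  have [i Aij] := Acol j.
  have /(le_sharp_mul _ _ n0 AR BR xR)/(_ i)[k kle] := xle j.
  apply/bigmax_geP; right; exists (i, j, k) => //=.
  move: kle; rewrite xj => /le_trans/(_ (leeD2l _ (xmax k))).
  move: (AR i j) (BR i k) Aij; case: (A i j) => [a| |] //.
  by case: (B i k) => [b| |] // _ _ _; rewrite -!EFinD lee_fin /=; lra.
have Ssup : has_sup S by [].
pose V (l : R) := [set x : 'cV[\bar R]_n | [/\ mx_Rmax x,
  forall j, x j 0%R <= 0 & forall j, l%:E + x j 0%R <= f x j 0%R]].
pose X (l : R) : 'cV[\bar R]_n :=
  \col_j ereal_sup [set x j 0%R | x in V l].
have V_le_X l x j : V l x -> x j 0%R <= X l j 0%R.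
  by move=> Vx; rewrite [X l _ _]mxE; apply: ereal_sup_ubound; exists x.
have X_le0 l j : X l j 0%R <= 0.
  by rewrite mxE; apply: ge_ereal_sup => _ [x [_ xle _] <-].
have XR l : mx_Rmax (X l).
  by move=> j i; rewrite ord1 -ltey (le_lt_trans (X_le0 l j)) ?ltry.
have X_sub l j : l%:E + X l j 0%R <= f (X l) j 0%R.
  rewrite addeC -leeBrDr // [X l _ _]mxE; apply: ge_ereal_sup => _ [x Vx <-].
  rewrite leeBrDr // addeC; have [_ _ /(_ j) xle] := Vx.
  by apply: le_trans xle _; apply: sharp_mul_mono => k; apply: V_le_X.
have X_anti l l' j : (l <= l')%R -> X l' j 0%R <= X l j 0%R.
  move=> ll'; rewrite [X l' _ _]mxE; apply: ge_ereal_sup => _ [x [xR xneg xle] <-].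
  apply: V_le_X; split=> // k; apply: le_trans (xle k).
  by rewrite leeD2r // lee_fin.
(* Normalising an eigenvector candidate to maximum 0 gives a coordinate depending on [l]; the
   pigeonhole makes it uniform. *)
have [j0 Xj0] : exists j, forall l, S l -> 0 <= X l j 0%R.
  apply: (@antitone_pigeonhole _ _ (Ordinal n0)).
    by move=> l l' j ll' /le_trans; apply; apply: X_anti.
  move=> l [x [xR xN xle]]; have [j [r [xj xmax]]] := fin_num_maxP xR xN.
  exists j; have <- : shift (- r) x j 0%R = 0 by rewrite mxE xj -EFinD addNr.
  apply: V_le_X; split; first exact: shift_Rmax.
    move=> k; rewrite mxE; move: (xmax k); case: (x k 0%R) => [s| |] //.
      by rewrite -EFinD !lee_fin; lra.
    by rewrite addeNy leNye.
  by move=> k; rewrite mxE /f sharp_mul_shift // addeCA leeD2l.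
pose y : 'cV[\bar R]_n := \col_j ereal_inf [set X l j 0%R | l in S].
have y_le_X l j : S l -> y j 0%R <= X l j 0%R.
  by move=> Sl; rewrite [y _ _]mxE; apply: ereal_inf_lbound; exists l.
have [l1 Sl1] := S0.
have yR : mx_Rmax y.
  move=> j i; rewrite ord1 -ltey; apply: le_lt_trans (y_le_X _ j Sl1) _.
  by rewrite ltey; apply: XR.
have y_sub l j : S l -> l%:E + y j 0%R <= f y j 0%R.
  move=> Sl; apply/le_sharp_mul => // i.
  (* To pass to the infimum over [l'], the witness [k] must not depend on [l']. *)
  have [k Hk] : exists k, forall l', S l' ->
      A i j + (l'%:E + y j 0%R) <= B i k + X l' k 0%R.
    apply: (@antitone_pigeonhole _ _ (Ordinal n0)).
      move=> a b k ab Hb; apply: le_trans (le_trans Hb _).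
        by apply/leeD2l/leeD2r; rewrite lee_fin.
      exact/leeD2l/X_anti.
    move=> l' Sl'; have /(le_sharp_mul _ _ n0 AR BR (XR _))/(_ i)[k kle] := X_sub l' j.
    by exists k; apply: le_trans kle; apply/leeD2l/leeD2l/y_le_X.
  exists k.
  (* Freeze [l] on the left: use the bound at the larger of [l] and [l'], then antitonicity of
     [X]. *)
  have {}Hk l' : S l' -> A i j + (l%:E + y j 0%R) <= B i k + X l' k 0%R.
    move=> Sl'; have [ll'|/ltW l'l] := leP l l'.
      by apply: le_trans (Hk _ Sl'); apply/leeD2l/leeD2r; rewrite lee_fin.
    by apply: le_trans (Hk _ Sl) _; apply/leeD2l/X_anti.
  move: (BR i k) Hk; case: (B i k) => [b| |] // _ Hk; last first.
    by rewrite !addNye; apply: le_trans (Hk _ Sl1) _.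
  rewrite addeC [leRHS]addeC -leeBlDr // [y k _]mxE.
  apply: le_ereal_inf_tmp => _ [l' Sl' <-]; rewrite leeBlDr // addeC [leRHS]addeC.
  exact: Hk.
exists (sup S); split; last by move=> l x xl; apply: sup_upper_bound => //; exists x.
exists y; split=> //.
  exists j0; rewrite -ltNye; apply: (@lt_le_trans _ _ 0); first exact: ltNy0.
  by rewrite mxE; apply: le_ereal_inf_tmp => _ [l Sl <-]; apply: Xj0.
move=> j; have {}y_sub l := y_sub l j; move: (yR j 0%R) y_sub.
case: (y j 0%R) => [r| |] // _; last first.
  by move=> _; rewrite addeNy leNye.
case: (f y j 0%R) => [s| |] Hs; rewrite ?leey //; last by have := Hs _ Sl1.
rewrite -EFinD lee_fin -lerBrDr; apply: ge_sup => // l Sl.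
by have := Hs _ Sl; rewrite -EFinD lee_fin lerBrDr.
Qed.

(** * Bounds on the spectral radius *)

Lemma le_spectral_radius (R : realType) (m n : nat) (A B : 'M[\bar R]_(m, n))
    (l : R) (x : 'cV[\bar R]_n) :
  (0 < n)%N -> mx_Rmax A -> mx_Rmax B -> (forall j, exists i, A i j != -oo) ->
  subeigenvector (sharp_mul A B) l x ->
  l%:E <= spectral_radius (sharp_mul A B).
Proof.
move=> n0 AR BR Acol xl.
have [L [[z [zR zN zle]] Lmax]] := subeigenvalue_max n0 AR BR Acol xl.
suff -> : spectral_radius (sharp_mul A B) = L%:E by rewrite lee_fin (Lmax _ _ xl).
(* Shifting [B] by [- L] moves the greatest sub-eigenvalue to 0. *)
pose B' : 'M[\bar R]_(m, n) := \matrix_(i, j) ((- L)%:E + B i j).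
have B'R : mx_Rmax B'.
  by move=> i j; rewrite mxE; move: (BR i j); case: (B i j).
have B'E (w : 'cV[\bar R]_n) j : mx_Rmax w ->
    sharp_mul A B' w j 0%R = (- L)%:E + sharp_mul A B w j 0%R.
  move=> wR; rewrite -sharp_mul_shift // /sharp_mul /=.
  suff -> : maxplus_mul B' w = maxplus_mul B (shift (- L) w) by [].
  apply/colP => i; rewrite !mxE; apply: eq_bigr => k _.
  by rewrite !mxE addeAC addeC [RHS]addeCA addeCA.
have [|d w d0 [wR wN wle]|w [wR wN wE]] := @fixed_point _ _ _ A B' z n0 AR B'R Acol.
- split=> // j; rewrite B'E // add0e; have := leeD2l (- L)%:E (zle j).
  by rewrite addeA -EFinD addNr add0e.
- suff : (L + d <= L)%R by lra.
  apply: (Lmax _ w); split=> // j; rewrite EFinD -addeA.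
  apply: le_trans (leeD2l _ (wle j)) _.
  by rewrite B'E // addeA -EFinD subrr add0e.
(* The fixed point shows that [L] is attained, so the default value of [max_set] is avoided; it is
   an upper bound because finite eigenvalues are sub-eigenvalues. *)
apply: max_setE.
  split=> //; exists w; split=> // j.
  by rewrite -wE B'E // addeA -EFinD subrr add0e.
move=> [s| |] [sy [w' [w'R w'N w'E]]] //; last exact: leNye.
by rewrite lee_fin (Lmax _ w') //; split=> // j; rewrite w'E.
Qed.

(** With [r] the maximum of [A i j + x j], reached at [j], and [g] the quotient, some [k] gives
    [l + r <= B i k + x k], hence [g + l + r <= A i k + x k <= r]. Finiteness of the row makes [r]
    finite. *)
Lemma spectral_radius_le_vdiv (R : realType) (m n : nat)
    (A B : 'M[\bar R]_(m, n)) (i : 'I_m) :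
  (0 < n)%N -> mx_Rmax A -> mx_Rmax B -> (exists j, B i j != -oo) ->
  finite_row A i ->
  spectral_radius (sharp_mul A B) <= - vdiv (row i A) (row i B).
Proof.
move=> n0 AR BR [j1 Bij1] /forallP Afin.
have rowR (M : 'M[\bar R]_(m, n)) : mx_Rmax M -> mx_Rmax (row i M).
  by move=> MR k l; rewrite mxE.
have := vdivP (vdiv (row i A) (row i B)) (rowR _ AR) (rowR _ BR).
case=> _ /(_ (lexx _)); set g := vdiv _ _ => gle.
rewrite /spectral_radius /max_set.
case: xgetP => [l _ [[ly [x [xR xN xE]]] _]|_]; last exact: leNye.
pose y : 'cV[\bar R]_n := \col_j (A i j + x j 0%R).
have yR : mx_Rmax y.
  move=> j k; rewrite mxE; move: (AR i j) (xR j 0%R).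
  by case: (A i j) => [a| |] //; case: (x j 0%R).
have yN : exists j, y j 0%R != -oo.
  case: xN => j xj; exists j; rewrite mxE; move: (Afin j) xj.
  by case: (A i j) => [a| |] //; case: (x j 0%R).
have [j [r [yj ymax]]] := fin_num_maxP yR yN.
have /(le_sharp_mul _ _ n0 AR BR xR)/(_ i)[k kle] :
    l + x j 0%R <= sharp_mul A B x j 0%R.
  by rewrite xE.
have {ymax} := ymax k; rewrite mxE; move: yj; rewrite mxE => yj yk.
have := gle k; rewrite !mxE => gk.
(* The finite entry [B i j1] excludes [g = +oo]. *)
have := gle j1; rewrite !mxE => gj1.
move: (Afin j1) Bij1 (BR i j1) gj1; case: (A i j1) => [a1| |] // _.
case: (B i j1) => [b1| |] // _ _.
move: ly kle gk; case: l xE => [l| |] // _ _; last by rewrite leNye.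
case: (g) => [g'| |] //; last by rewrite leey.
move: (Afin j) (Afin k) yj yk; case: (A i j) => [aj| |] //.
case: (A i k) => [ak| |] // _ _.
case: (x j 0%R) => [xj| |] // [<-]; move: (BR i k) (xR k 0%R).
case: (B i k) => [b| |] //; case: (x k 0%R) => [xk| |] // _ _.
by rewrite -!EFinD -EFinN !lee_fin => *; lra.
Qed.

(** * From the two-sided eigenproblem to the interval bounds *)

Lemma subeigenvector_of_maxplus_mul (R : realType) (m n : nat) (A B : 'M[\bar R]_(m, n))
    (l : R) (x : 'cV[\bar R]_n) :
  (0 < n)%N -> mx_Rmax A -> mx_Rmax B ->
  mx_Rmax x -> (exists j, x j 0%R != -oo) ->
  (forall i, l%:E + maxplus_mul A x i 0%R <= maxplus_mul B x i 0%R) ->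
  subeigenvector (sharp_mul A B) l x.
Proof.
move=> n0 AR BR xR xN lAB; split=> // j.
apply/(le_sharp _ _ AR (maxplus_mul_Rmax BR xR)) => i.
apply: le_trans (lAB i); rewrite addeCA leeD2l //.
by apply/le_maxplus_mul => //; exists j.
Qed.

Theorem theorem5 (R : realType) (m n : nat) (hm : (0 < m)%N) (hn : (0 < n)%N)
  (A B : 'M[\bar R]_(m, n)) (hA : mx_Rmax A) (hB : mx_Rmax B)
  (hArow : forall i, exists j, A i j != -oo)
  (hAcol : forall j, exists i, A i j != -oo)
  (hBrow : forall i, exists j, B i j != -oo)
  (hBcol : forall j, exists i, B i j != -oo) :
  EFin @` spec A B `<=`
    `[- spectral_radius (sharp_mul A B), spectral_radius (sharp_mul B A)] /\
  `[- spectral_radius (sharp_mul A B), spectral_radius (sharp_mul B A)] `<=`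
    `[D_lower A B, D_upper A B].
Proof.
split=> [_ [l [x [xR xN xE]] <-]|x].
  rewrite /= in_itv /=; apply/andP; split.
    rewrite leeNl -EFinN; apply: (@le_spectral_radius _ _ _ A B (- l) x) => //.
    apply: subeigenvector_of_maxplus_mul => // i.
    by rewrite xE addeA -EFinD addNr add0e.
  apply: (@le_spectral_radius _ _ _ B A l x) => //.
  by apply: subeigenvector_of_maxplus_mul => // i; rewrite xE.
rewrite /= !in_itv /= => /andP[rx xr]; apply/andP; split.
  apply: le_trans rx; apply/bigmax_leP; split=> [|i iA]; first exact: leNye.
  by rewrite leeNr spectral_radius_le_vdiv.
apply: (le_trans xr); rewrite /D_upper leeNr.
apply/bigmax_leP; split=> [|i iB]; first exact: leNye.
by rewrite leeNr spectral_radius_le_vdiv.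
Qed.
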